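(* Let $N=\{1,\dots,n\}$ and $\ell=(\ell_1,\dots,\ell_n)\in\mathbb{R}^n_{>0}$. A solution $\phi$ satisfies both higher direct liability and independent indirect liabilities if and only if there exists $\pi\in[0,1]^n$ such that \[ \phi(i,j)=(1-\pi_j)\,\phi(j,j)\quad\text{for all } i<j \text{ in } N, \] and \[ \phi(i,i)=\ell_i+\sum_{k>i}\Big(\prod_{i<j\le k}\pi_j\Big)\ell_k\quad\text{for all } i\in N. \]
   Context: A solution is a function $\phi:N\times N\to\mathbb{R}_{\ge 0}$ with $\phi(i,j)=0$ for all $j<i$ and (balance) $\sum_{j\ge i}\phi(i,j)=\sum_{j\ge i}\ell_j$ for all $i\in N$. Higher direct liability: for all $j<k$ in $N$, $\phi(j,k)\le\phi(k,k)$. Independent indirect liabilities: for all $i<j<k$ in $N$, $\phi(i,k)=\phi(j,k)$. *)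

(* Defs.v *)
From HB Require Import structures.
From mathcomp Require Import all_boot all_order all_algebra.
From mathcomp Require Import reals.

Set Implicit Arguments.
Unset Strict Implicit.
Unset Printing Implicit Defensive.

Import Order.TTheory GRing.Theory Num.Theory.
Local Open Scope ring_scope.

(* The agents N = {1, ..., n} are represented by 'I_n = {0, ..., n-1} with its
   natural order; only the order of the indices matters. Comparisons of indices
   are in nat (%N), through the coercion of 'I_n to nat. *)

Definition is_solution (R : realType) (n : nat) (l : 'I_n -> R)
    (phi : 'I_n -> 'I_n -> R) : Prop :=
  [/\ forall i j : 'I_n, 0 <= phi i j,
      forall i j : 'I_n, (j < i)%N -> phi i j = 0
    & forall i : 'I_n,
        \sum_(j < n | (i <= j)%N) phi i j = \sum_(j < n | (i <= j)%N) l j].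

Definition higher_direct_liability (R : realType) (n : nat)
    (phi : 'I_n -> 'I_n -> R) : Prop :=
  forall j k : 'I_n, (j < k)%N -> phi j k <= phi k k.

Definition independent_indirect_liabilities (R : realType) (n : nat)
    (phi : 'I_n -> 'I_n -> R) : Prop :=
  forall i j k : 'I_n, (i < j)%N -> (j < k)%N -> phi i k = phi j k.

(* Main.v *)
Require Import Defs.
From HB Require Import structures.
From mathcomp Require Import all_boot all_order all_algebra.
From mathcomp Require Import reals.
From mathcomp Require Import ring.

Set Implicit Arguments.
Unset Strict Implicit.
Unset Printing Implicit Defensive.

Import Order.TTheory GRing.Theory Num.Theory.
Local Open Scope ring_scope.

(* The liability at j of every agent i < j is the same number phi(1,j); its ratio
   to phi(j,j) is 1 - pi_j. Subtracting the balance conditions of i and i+1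
   leaves phi(i,i) = l_i + pi_{i+1} phi(i+1,i+1), which unfolds to the formula
   of the statement. *)

Section DiagonalRecursion.
Variables (R : realType) (n : nat) (l : 'I_n -> R).

Definition diagonal (pi : 'I_n -> R) (i : 'I_n) : R :=
  l i + \sum_(k < n | (i < k)%N) (\prod_(j < n | (i < j <= k)%N) pi j) * l k.

Lemma sum_ord_geD1 (F : 'I_n -> R) (i : 'I_n) :
  \sum_(j < n | (i <= j)%N) F j = F i + \sum_(j < n | (i < j)%N) F j.
Proof.
rewrite (bigD1 i) //=; congr (_ + _); apply: eq_bigl => j.
by rewrite ltn_neqAle andbC eq_sym.
Qed.

Lemma sum_ord_gt_succ (F : 'I_n -> R) (i k : 'I_n) : k = i.+1 :> nat ->
  \sum_(j < n | (i < j)%N) F j = F k + \sum_(j < n | (k < j)%N) F j.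
Proof. by move=> ik; rewrite -sum_ord_geD1 ik. Qed.

Lemma sum_ord_gt_last (F : 'I_n -> R) (i : 'I_n) : i.+1 = n ->
  \sum_(j < n | (i < j)%N) F j = 0.
Proof.
move=> iE; rewrite big_pred0 // => j.
by apply/negbTE; rewrite -leqNgt -ltnS iE.
Qed.

(** Every product in [diagonal pi i] contains the factor [pi k]: the term of index [k] is
    [pi k * l k], and each later term is [pi k] times the matching term of [diagonal pi k]. *)
Lemma diagonal_succ (pi : 'I_n -> R) (i k : 'I_n) : k = i.+1 :> nat ->
  diagonal pi i = l i + pi k * diagonal pi k.
Proof.
move=> ik; rewrite /diagonal (sum_ord_gt_succ _ ik) mulrDr mulr_sumr.
congr (_ + (_ + _)).
  rewrite (big_pred1 k) // => j.
  by rewrite /= -ik -eqn_leq eq_sym.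
apply: eq_bigr => m km; rewrite mulrA; congr (_ * _).
rewrite (bigD1 k) /=; last by rewrite -ik leqnn ltnW.
congr (_ * _); apply: eq_bigl => j.
by rewrite -ik (ltn_neqAle k j) [k == j :> nat]eq_sym andbC -andbA.
Qed.

Lemma diagonal_last (pi : 'I_n -> R) (i : 'I_n) : i.+1 = n ->
  diagonal pi i = l i.
Proof. by move=> iE; rewrite /diagonal sum_ord_gt_last ?addr0. Qed.

Lemma solution_diagonal (phi : 'I_n -> 'I_n -> R) (pi : 'I_n -> R) :
    is_solution l phi ->
    (forall i j : 'I_n, (i < j)%N -> phi i j = (1 - pi j) * phi j j) ->
  forall i, phi i i = diagonal pi i.
Proof.
(* Induction on [n - i], hence from the last agent down, since the recursion expresses index [i]
   through its successor. *)
move=> [_ _ bal] phiE i; have [m] := ubnP (n - i)%N.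
elim: m i => // m IHm i; rewrite ltnS => lem.
have := bal i; rewrite !sum_ord_geD1.
case: (ltngtP i.+1 n) => [i1n|n_lt|iE].
- pose k := Ordinal i1n; have ik : k = i.+1 :> nat by [].
  rewrite !(sum_ord_gt_succ _ ik) -(sum_ord_geD1 l k) -(bal k) sum_ord_geD1.
  (* Beyond [k] the rows [i] and [k] coincide, both being [(1 - pi j) * phi j j], so these tails
     cancel and leave [phi i i + phi i k = l i + phi k k]. *)
  rewrite (eq_bigr (phi k)); last first.
    by move=> j kj; rewrite (phiE k) // (phiE i) // (ltn_trans _ kj).
  rewrite !addrA => /addIr; rewrite (phiE i k) // (diagonal_succ _ ik) -IHm.
    by move/(canRL (addrK _)) => ->; ring.
  by apply: leq_trans lem; rewrite ltn_sub2l.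
- by move: n_lt; rewrite ltnNge ltn_ord.
by rewrite !sum_ord_gt_last // !addr0 diagonal_last.
Qed.

End DiagonalRecursion.

Theorem proposition1 (R : realType) (n : nat) (l : 'I_n -> R)
    (l_gt0 : forall i : 'I_n, 0 < l i)
    (phi : 'I_n -> 'I_n -> R) (phi_sol : is_solution l phi) :
  (higher_direct_liability phi /\ independent_indirect_liabilities phi) <->
  (exists pi : 'I_n -> R,
    [/\ forall j : 'I_n, 0 <= pi j <= 1,
        forall i j : 'I_n, (i < j)%N -> phi i j = (1 - pi j) * phi j j
      & forall i : 'I_n,
          phi i i = l i + \sum_(k < n | (i < k)%N)
                            (\prod_(j < n | (i < j <= k)%N) pi j) * l k]).
Proof.
have [phi_ge0 _ _] := phi_sol; split; last first.
  (* In [(1 - pi k) * phi k k] the first factor is at most 1, and the row index does not occur. *)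
  move=> [pi [pi01 phiE _]]; split=> [j k jk|i j k ij jk].
    by rewrite phiE // ler_piMl // gerBl; have /andP[] := pi01 k.
  by rewrite (phiE j) // (phiE i) // (ltn_trans ij).
(* The witness refers to the first agent [ord0], so the empty set of agents is treated apart. *)
case: n l l_gt0 phi phi_sol phi_ge0 => [|n'] l' _ phi' sol phi_ge0 [hdl iil].
  by exists (fun=> 0); split=> [[]|[]|[]].
(* The index [j = ord0] is included because [pi] must lie in [0,1] there too. *)
have top_le j : phi' ord0 j <= phi' j j.
  by have [->//|j0] := eqVneq j ord0; apply: hdl; rewrite lt0n.
(* Junk value: if phi j j = 0 then pi j = 1, and top_le gives phi ord0 j = 0. *)
pose pi j := 1 - phi' ord0 j / phi' j j.
have phiE (i j : 'I_n'.+1) : (i < j)%N -> phi' i j = (1 - pi j) * phi' j j.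
  move=> ij; rewrite /pi subKr.
  have -> : phi' i j = phi' ord0 j.
    by have [->//|i0] := eqVneq i ord0; rewrite (iil ord0 i) // lt0n.
  have [jj0|jj_neq0] := eqVneq (phi' j j) 0; last by rewrite divfK.
  by rewrite jj0 mulr0; apply/le_anti; rewrite phi_ge0 -jj0 top_le.
exists pi; split=> // [j|i]; last exact: solution_diagonal.
(* Nonnegativity of the quotient gives [pi j <= 1]; what remains is that the quotient is at most 1,
   which is [top_le] when [phi' j j] is nonzero. *)
rewrite subr_ge0 gerBl divr_ge0 // andbT.
have [->|jj_neq0] := eqVneq (phi' j j) 0; first by rewrite invr0 mulr0.
by rewrite ler_pdivrMr ?mul1r // lt_def jj_neq0 phi_ge0.
Qed.
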